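(* Let $f$ satisfy Assumption A, $g$ satisfy Assumption B, $L>L_f$, and let $(u_k)$ be a sequence of proximal gradient iterates with parameter $L$ having a weak sequential limit point $u^*\in L^2(\Omega)$. Assume that the whole sequence satisfies $\nabla f(u_k)(x)\to\nabla f(u^* )(x)$ for almost all $x\in\Omega$. Then $u^*(x)\in\mathcal{G}_L(-\nabla f(u^* )(x))$ for almost all $x\in\Omega$.
   Context: $\Omega\subset\mathbb{R}^n$ Lebesgue measurable with finite measure. Assumption A: $f:L^2(\Omega)\to\mathbb{R}$ bounded below, weakly lower semicontinuous, Fréchet differentiable, $\nabla f$ Lipschitz with constant $L_f$. Assumption B on $g:\mathbb{R}\to\mathbb{R}\cup\{+\infty\}$: (B1) lsc, symmetric, $g(0)=0$; (B2) $g(u)<\infty$ for some $u\ne0$; (B3) one of (B3a) $g$ twice differentiable on some $(0,\epsilon)$, $\limsup_{u\searrow0}g''(u)\in(-\infty,0)$; (B3b) same differentiability, $\lim_{u\searrow0}g''(u)=-\infty$; (B3c) $\liminf_{u\searrow0}g(u)>0$; (B4) $g\ge0$. Proximal gradient iterates with parameter $L>0$: $(u_k)_{k\ge0}\subset L^2(\Omega)$, arbitrary $u_0$, each $u_{k+1}$ a global minimizer over $L^2(\Omega)$ of $f(u_k)+\int_\Omega\nabla f(u_k)(u-u_k)\,dx+\frac L2\|u-u_k\|^2_{L^2(\Omega)}+\int_\Omega g(u(x))\,dx$. $\mathcal{G}_L:\mathbb{R}\rightrightarrows\mathbb{R}$: $u\in\mathcal{G}_L(z)$ iff $u$ is a global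 minimizer of $v\mapsto -zv+\frac L2(v-u)^2+g(v)$ over $v\in\mathbb{R}$. *)

(* Defs.v *)
From HB Require Import structures.
From mathcomp Require Import all_boot all_order all_algebra.
From mathcomp Require Import all_classical all_reals all_analysis.

Set Implicit Arguments.
Unset Strict Implicit.
Unset Printing Implicit Defensive.

Import Order.TTheory GRing.Theory Num.Theory.
Import numFieldNormedType.Exports.

Local Open Scope classical_set_scope.
Local Open Scope ring_scope.

(** The domain Omega is modelled as a finite measure space (T, mu):
    L^2(Omega) = functions T -> R that are measurable with finite L^2 norm
    (elements of L^2 are represented by representatives). *)

Section L2.
Context {d : measure_display} {T : measurableType d} {R : realType}.
Variable mu : {measure set T -> \bar R}.

Definition L2 (u : T -> R) : Prop := u \in Lfun mu 2%:E.

Definition l2norm (u : T -> R) : R := fine (Lnorm mu 2%:E (EFin \o u)).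

Definition l2inner (u v : T -> R) : R := fine (\int[mu]_x (u x * v x)%:E).

Definition weak_cvg (v : nat -> T -> R) (u : T -> R) : Prop :=
  forall w, L2 w -> (fun k => l2inner (v k) w) @ \oo --> l2inner u w.

Definition weak_seq_limit_point (v : nat -> T -> R) (u : T -> R) : Prop :=
  exists phi : nat -> nat, {homo phi : m n / (m < n)%N >-> (m < n)%N} /\
    weak_cvg (fun j => v (phi j)) u.

Definition assumptionA (f : (T -> R) -> R) (gradf : (T -> R) -> (T -> R))
    (Lf : R) : Prop :=
  (* f is well defined on L^2 (does not depend on the representative) *)
  (forall u v, L2 u -> L2 v -> ae_eq mu setT u v -> f u = f v) /\
  (exists c : R, forall u, L2 u -> c <= f u) /\
  (forall (v : nat -> T -> R) u, (forall k, L2 (v k)) -> L2 u ->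
     weak_cvg v u -> ((f u)%:E <= limn_einf (fun k => (f (v k))%:E))%E) /\
  (forall u, L2 u -> L2 (gradf u) /\
     forall eps : R, 0 < eps -> exists2 delta : R, 0 < delta &
       forall h, L2 h -> l2norm h < delta ->
         `| f (u \+ h) - f u - l2inner (gradf u) h | <= eps * l2norm h) /\
  0 <= Lf /\
  (forall u v, L2 u -> L2 v ->
     l2norm (gradf u \- gradf v) <= Lf * l2norm (u \- v)).

End L2.

Section AssumptionB.
Context {R : realType}.

Definition rlimsup0 (phi : R -> \bar R) : \bar R :=
  ereal_inf [set ereal_sup (phi @` `]0, e[) | e in [set e : R | 0 < e]].
Definition rliminf0 (phi : R -> \bar R) : \bar R :=
  ereal_sup [set ereal_inf (phi @` `]0, e[) | e in [set e : R | 0 < e]].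

Definition twice_diff_near0 (g : R -> \bar R) (eps : R) (h : R -> R) : Prop :=
  0 < eps /\
  (forall x, 0 < x < eps -> g x = (h x)%:E) /\
  (forall x, 0 < x < eps -> derivable h x 1 /\ derivable (derive1 h) x 1).

Definition B3a (g : R -> \bar R) : Prop :=
  exists eps h, twice_diff_near0 g eps h /\
    (-oo < rlimsup0 (fun x => (derive1 (derive1 h) x)%:E) < 0%:E)%E.

Definition B3b (g : R -> \bar R) : Prop :=
  exists eps h, twice_diff_near0 g eps h /\
    derive1 (derive1 h) x @[x --> 0^'+] --> -oo.

Definition B3c (g : R -> \bar R) : Prop := (0%:E < rliminf0 g)%E.

Definition assumptionB (g : R -> \bar R) : Prop :=
  lower_semicontinuous g /\ (forall x, g (- x) = g x) /\ g 0 = 0%:E /\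
  (exists2 u, u != 0 & (g u < +oo)%E) /\
  (B3a g \/ B3b g \/ B3c g) /\
  (forall x, (0%:E <= g x)%E).

Definition GL (L : R) (g : R -> \bar R) (z u : R) : Prop :=
  forall v : R,
    ((- z * u + L / 2 * (u - u) ^+ 2)%:E + g u <=
     (- z * v + L / 2 * (v - u) ^+ 2)%:E + g v)%E.

End AssumptionB.

Section Prox.
Context {d : measure_display} {T : measurableType d} {R : realType}.
Variable mu : {measure set T -> \bar R}.

Definition prox_model (f : (T -> R) -> R) (gradf : (T -> R) -> (T -> R))
    (g : R -> \bar R) (L : R) (uk u : T -> R) : \bar R :=
  ((f uk + l2inner mu (gradf uk) (u \- uk)
     + L / 2 * l2norm mu (u \- uk) ^+ 2)%:E
   + \int[mu]_x g (u x))%E.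

Definition prox_grad_iterates (f : (T -> R) -> R)
    (gradf : (T -> R) -> (T -> R)) (g : R -> \bar R) (L : R)
    (u : nat -> T -> R) : Prop :=
  L2 mu (u 0%N) /\
  forall k, L2 mu (u k.+1) /\
    forall w, L2 mu w ->
      (prox_model f gradf g L (u k) (u k.+1) <= prox_model f gradf g L (u k) w)%E.

End Prox.

(* Main.v *)
Require Import Defs.
From HB Require Import structures.
From mathcomp Require Import all_boot all_order all_algebra.
From mathcomp Require Import all_classical all_reals all_analysis.
From mathcomp Require Import measurable_realfun ring lra.

Set Implicit Arguments.
Unset Strict Implicit.
Unset Printing Implicit Defensive.

Import Order.TTheory GRing.Theory Num.Theory.
Import numFieldNormedType.Exports.

Local Open Scope classical_set_scope.
Local Open Scope ring_scope.

(** Comparing [u_(k+1)] with [u_k] and using the descent lemma, the energy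
    [f + \int g] decreases by at least [(L - Lf) / 2 * |u_(k+1) - u_k|^2], so
    these squared norms are summable and [u_(k+1)(x) - u_k(x) -> 0] almost
    everywhere.  Each step moreover minimizes its integrand almost everywhere,
    hence by lower semicontinuity of [g] every cluster point of
    [u_k(x)] belongs to [G_L(- gradf u* (x))].  Finally [u*(x)] is itself a
    cluster point: as a weak limit it lies almost everywhere between the lower
    and upper limits of [u_k(x)], and since the increments vanish, the cluster
    points fill that interval. *)

(** * Square-integrable functions, Cauchy-Schwarz, and ordered functions with equal integrals *)

Section square_integrable.
Context {d : measure_display} {T : measurableType d} {R : realType}.
Context (mu : {measure set T -> \bar R}).
Implicit Types u v w : T -> R.

Lemma L2_measurable u : L2 mu u -> measurable_fun [set: T] u.
Proof. by move=> /andP[/[!inE]]. Qed.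

Lemma L2_integrable_sqr u : L2 mu u ->
  mu.-integrable [set: T] (fun x => (u x ^+ 2)%:E).
Proof. exact: Lfun2_integrable_sqr. Qed.

Lemma integral_sqr_Lnorm u :
  (\int[mu]_x (u x ^+ 2)%:E = Lnorm mu 2%:E (EFin \o u) `^ 2)%E.
Proof.
rewrite poweR_Lnorm ?pnatr_eq0//; apply: eq_integral => x _ /=.
by rewrite powR_mulrn// real_normK ?num_real.
Qed.

Lemma L2P u : L2 mu u <-> measurable_fun [set: T] u /\
  mu.-integrable [set: T] (fun x => (u x ^+ 2)%:E).
Proof.
split=> [u2|[mu_ iu]].
  by split; [exact: L2_measurable|exact: L2_integrable_sqr].
apply/andP; split; rewrite inE//= /finite_norm.
have /integrable_lty := iu => /(_ measurableT).
rewrite integral_sqr_Lnorm; exact: lty_poweRy.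
Qed.

Lemma sqr_l2norm u : L2 mu u -> l2norm mu u ^+ 2 = \int[mu]_x (u x ^+ 2).
Proof.
move=> u2; rewrite /Rintegral integral_sqr_Lnorm /l2norm.
have : (Lnorm mu 2%:E (EFin \o u) < +oo)%E by move: u2 => /andP[_ /[!inE]].
have := Lnorm_ge0 mu 2%:E (EFin \o u).
case: (Lnorm mu 2%:E (EFin \o u)) => //= r r0 _.
by rewrite powR_mulrn.
Qed.

Lemma l2norm_ge0 u : 0 <= l2norm mu u.
Proof. exact/fine_ge0/Lnorm_ge0. Qed.

Lemma L2D u v : L2 mu u -> L2 mu v -> L2 mu (fun x => u x + v x).
Proof. exact: (proj2 (Lfun_addr_closed mu (lee1n 2))). Qed.

Lemma L2Z a u : L2 mu u -> L2 mu (fun x => a * u x).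
Proof.
move=> u2; have := @Lfun_scale _ _ _ mu u a 2 (ler1n R 2) u2.
rewrite (_ : (a \o* u) = (fun x => a * u x))//.
by apply/funext => x /=; rewrite mulrC.
Qed.

Lemma L2B u v : L2 mu u -> L2 mu v -> L2 mu (fun x => u x - v x).
Proof.
move=> u2 v2; have := L2D u2 (L2Z (-1) v2).
by congr (L2 mu _); apply/funext => x /=; rewrite mulN1r.
Qed.

Lemma L2_integrableM u v : L2 mu u -> L2 mu v ->
  mu.-integrable [set: T] (fun x => (u x * v x)%:E).
Proof. by move=> u2 v2; apply/Lfun1_integrable/Lfun2_mul_Lfun1. Qed.

(** The square of the glued function is dominated by [u ^+ 2 + v ^+ 2]. Gluing produces both the
    competitors for the proximal step and the indicators used as weak test functions. *)
Lemma L2_if (b : T -> bool) u v : measurable_fun [set: T] b ->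
  L2 mu u -> L2 mu v -> L2 mu (fun x => if b x then u x else v x).
Proof.
move=> mb u2 v2.
have mw : measurable_fun [set: T] (fun x => if b x then u x else v x).
  by apply: measurable_fun_ifT => //; exact: L2_measurable.
apply/L2P; split=> //.
apply: (@le_integrable _ _ _ mu _ measurableT _
  (fun x => (u x ^+ 2)%:E + (v x ^+ 2)%:E)%E).
- by apply/measurable_EFinP; exact: measurable_funX.
- move=> x _; rewrite -EFinD !abse_EFin lee_fin !ger0_norm ?addr_ge0 ?sqr_ge0//.
  by case: ifP => _; rewrite ?lerDl ?lerDr sqr_ge0.
- by apply: integrableD => //; exact: L2_integrable_sqr.
Qed.

Lemma l2innerBl u v w : L2 mu u -> L2 mu v -> L2 mu w ->
  l2inner mu (u \- v) w = l2inner mu u w - l2inner mu v w.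
Proof.
move=> u2 v2 w2; rewrite -[RHS]RintegralB//; last 2 first.
- exact: L2_integrableM.
- exact: L2_integrableM.
by apply: eq_Rintegral => x _; rewrite mulrBl.
Qed.

Lemma l2innerZr a u v : L2 mu u -> L2 mu v ->
  l2inner mu u (fun x => a * v x) = a * l2inner mu u v.
Proof.
move=> u2 v2; rewrite -[RHS]RintegralZl//; last exact: L2_integrableM.
by apply: eq_Rintegral => x _; rewrite mulrCA.
Qed.

Lemma l2normZ a u : L2 mu u -> l2norm mu (fun x => a * u x) = `|a| * l2norm mu u.
Proof.
move=> u2; apply/eqP; rewrite -(@eqrXn2 _ 2)// ?l2norm_ge0 ?mulr_ge0 ?l2norm_ge0//.
rewrite exprMn !sqr_l2norm//; last exact: L2Z.
rewrite real_normK ?num_real// -RintegralZl//; last exact: L2_integrable_sqr.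
by apply/eqP; apply: eq_Rintegral => x _; rewrite exprMn.
Qed.

(** Cauchy-Schwarz, from the nonnegativity for all [t] of the integral of [(u - t v) ^+ 2]. *)
Lemma l2inner_le u v : L2 mu u -> L2 mu v ->
  l2inner mu u v <= l2norm mu u * l2norm mu v.
Proof.
move=> u2 v2; have u0 := l2norm_ge0 u; have v0 := l2norm_ge0 v.
have iu := L2_integrable_sqr u2; have iv := L2_integrable_sqr v2.
have iuv := L2_integrableM u2 v2.
have quad t : 0 <= l2norm mu u ^+ 2 + - 2 * t * l2inner mu u v
    + t ^+ 2 * l2norm mu v ^+ 2.
  rewrite !sqr_l2norm// /l2inner -!RintegralZl//.
  have iuv' : mu.-integrable [set: T] (EFin \o (fun x => - 2 * t * (u x * v x))).
    exact: (integrableZl measurableT _ iuv).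
  have iv' : mu.-integrable [set: T] (EFin \o (fun x => t ^+ 2 * v x ^+ 2)).
    exact: (integrableZl measurableT _ iv).
  rewrite -!RintegralD//; last first.
    exact: (integrableD measurableT iu iuv').
  apply: Rintegral_ge0 => x _.
  rewrite (_ : _ + _ = (u x - t * v x) ^+ 2); [exact: sqr_ge0|ring].
have [v00|vn0] := eqVneq (l2norm mu v) 0.
  (* With [v] of norm zero the quadratic is affine in [t]; were the inner product positive, this [t]
     would give it the value -1. *)
  have := quad ((l2norm mu u ^+ 2 + 1) / (2 * l2inner mu u v)).
  rewrite v00 mulr0; have [//|c0] := lerP (l2inner mu u v) 0.
  rewrite (_ : _ + _ = -1); first by lra.
  by field; rewrite gt_eqF.
have vp : 0 < l2norm mu v by rewrite lt_neqAle eq_sym vn0.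
(* At this [t] the two square terms coincide and the quadratic becomes a multiple of the difference
   to be shown nonnegative. *)
have := quad (l2norm mu u / l2norm mu v).
have -> : l2norm mu u ^+ 2 + - 2 * (l2norm mu u / l2norm mu v) * l2inner mu u v
  + (l2norm mu u / l2norm mu v) ^+ 2 * l2norm mu v ^+ 2 =
  2 * (l2norm mu u / l2norm mu v) * (l2norm mu u * l2norm mu v - l2inner mu u v).
  by field.
have [u00|un0] := eqVneq (l2norm mu u) 0.
  (* With [u] of norm zero the previous factor vanishes, so the minimizing [t] is taken instead; it
     forces the inner product to be 0. *)
  have := quad ((l2norm mu v ^+ 2)^-1 * l2inner mu u v).
  rewrite u00 mul0r (_ : _ + _ = - (l2inner mu u v ^+ 2 / l2norm mu v ^+ 2)).
    rewrite oppr_ge0 pmulr_lle0 ?invr_gt0 ?exprn_gt0// => c2 _.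
    by rewrite ?mul0r; nra.
  by field.
have up : 0 < l2norm mu u by rewrite lt_neqAle eq_sym un0.
by rewrite pmulr_rge0 ?subr_ge0// mulr_gt0// divr_gt0.
Qed.

(** The nonnegative function [G - F] has integral at most 0, hence vanishes almost everywhere. *)
Lemma le_Rintegral_eq_ae (F G : T -> R) :
  mu.-integrable [set: T] (EFin \o F) -> mu.-integrable [set: T] (EFin \o G) ->
  (forall x, F x <= G x) -> \int[mu]_x G x <= \int[mu]_x F x ->
  {ae mu, forall x, G x = F x}.
Proof.
move=> iF iG FG le1.
have iD : mu.-integrable [set: T] (EFin \o (fun x => G x - F x)).
  exact: (integrableB measurableT iG iF).
have : (\int[mu]_x `| (G x - F x)%:E | = 0)%E.
  under eq_integral do rewrite gee0_abs ?lee_fin ?subr_ge0//.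
  rewrite -[LHS]fineK; last exact: integrable_fin_num.
  congr EFin; apply/eqP; rewrite eq_le; apply/andP; split.
    by rewrite [leLHS]RintegralB// subr_le0.
  by apply: Rintegral_ge0 => x _; rewrite subr_ge0.
move/ae_eq_integral_abs => /(_ measurableT)/(_ (measurable_int _ iD)).
by apply: filterS => x /(_ Logic.I)[] /eqP; rewrite subr_eq0 => /eqP.
Qed.

End square_integrable.

(** * Descent lemma for a function with Lipschitz gradient *)

Section descent_lemma.
Context {d : measure_display} {T : measurableType d} {R : realType}.
Context (mu : {measure set T -> \bar R}).
Context (f : (T -> R) -> R) (gradf : (T -> R) -> (T -> R)) (Lf : R).
Implicit Types u v h : T -> R.

Lemma is_derive_line u h (t : R) : assumptionA mu f gradf Lf ->
  L2 mu u -> L2 mu h ->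
  is_derive t 1 (fun s : R => f (fun x => u x + s * h x))
    (l2inner mu (gradf (fun x => u x + t * h x)) h).
Proof.
move=> [_ [_ [_ [fgrad _]]]] u2 h2.
set p := (fun x => u x + t * h x).
have p2 : L2 mu p by apply: L2D => //; exact: L2Z.
have [g2 dfp] := fgrad _ p2.
have H0 := l2norm_ge0 mu h.
suff dlim : (fun s : R => s^-1 *: (f (fun x => u x + (s *: 1 + t) * h x) - f p))
    @ 0^' --> l2inner mu (gradf p) h.
  by apply: DeriveDef; [apply/cvg_ex; eexists; exact: dlim|exact: cvg_lim].
apply/cvgrPdist_le => e e0.
(* The direction [h] may have norm 0, so [l2norm mu h + 1] serves as divisor below. *)
have H1 : 0 < l2norm mu h + 1 by lra.
have [|dl dl0 hdl] := dfp (e / (l2norm mu h + 1)); first by rewrite divr_gt0.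
near=> s.
have s0 : s != 0 by near: s; exact: nbhs_dnbhs_neq.
have sd : `|s| < dl / (l2norm mu h + 1).
  near: s; apply: dnbhs0_lt; exact: divr_gt0.
have := hdl (fun x => s * h x) (L2Z s h2).
rewrite l2normZ// l2innerZr//.
have -> : p \+ (fun x => s * h x) = (fun x => u x + (s *: 1 + t) * h x).
  by apply/funext => x; rewrite /p /= /GRing.scale/=; ring.
have sp : 0 < `|s| by rewrite normr_gt0.
move=> /(_ _)/wrap[|].
  have : `|s| * (l2norm mu h + 1) < dl by rewrite -ltr_pdivlMr.
  by nra.
set D := f _ - f _ => le1.
have -> : l2inner mu (gradf p) h - s^-1 *: D =
  - s^-1 * (D - s * l2inner mu (gradf p) h).
  by rewrite /GRing.scale/=; field.
rewrite normrM normrN normfV mulrC ler_pdivrMr//.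
apply: le_trans le1 _.
rewrite (mulrC `|s|) mulrA ler_wpM2r// -mulrA ler_piMr// ?(ltW e0)//.
by rewrite mulrC ler_pdivrMr// mul1r lerDl.
Unshelve. all: by end_near. Qed.

(** Mean value theorem on the segment from [u] to [v]: subtracting the claimed upper model from [f]
    leaves [psi], whose derivative is nonpositive on (0, 1) by Cauchy-Schwarz and the Lipschitz
    bound. *)
Lemma descent_lemma u v : assumptionA mu f gradf Lf -> L2 mu u -> L2 mu v ->
  f v <= f u + l2inner mu (gradf u) (v \- u) + Lf / 2 * l2norm mu (v \- u) ^+ 2.
Proof.
move=> A u2 v2; set h := v \- u.
have h2 : L2 mu h by exact: L2B.
have [_ [_ [_ [fgrad [Lf0 gLip]]]]] := A.
set c := l2inner mu (gradf u) h; set H := l2norm mu h.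
pose p (t : R) := fun x => u x + t * h x.
pose psi (t : R) := f (p t) - c * t - Lf / 2 * H ^+ 2 * t ^+ 2.
have dpsi (t : R) : is_derive t 1 psi
    (l2inner mu (gradf (p t)) h - c - Lf * H ^+ 2 * t).
  rewrite /psi; have := is_derive_line t A u2 h2.
  rewrite -/(p t) => df.
  apply: is_derive_eq.
  by rewrite /GRing.scale/=; field.
have p0 : p 0 = u by apply/funext => x; rewrite /p mul0r addr0.
have p1 : p 1 = v by apply/funext => x; rewrite /p /h /= mul1r subrKC.
have [|t] := @MVT R psi _ 0 1 ltr01 (fun t _ => dpsi t).
  apply: continuous_subspaceT => t.
  exact/differentiable_continuous/derivable1_diffP/(@ex_derive _ _ _ _ _ _ _ (dpsi t)).
rewrite in_itv/= => /andP[t0 t1].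
rewrite subr0 mulr1 /psi p0 p1.
have pt2 : L2 mu (p t) by apply: L2D => //; exact: L2Z.
have [gp2 _] := fgrad _ pt2; have [gu2 _] := fgrad _ u2.
rewrite /c -l2innerBl// -/c.
have := gLip _ _ pt2 u2.
have -> : p t \- u = (fun x => t * h x) by apply/funext => x; rewrite /p /=; ring.
rewrite l2normZ// gtr0_norm// -/H => lip.
have cs := l2inner_le (L2B gp2 gu2) h2.
have H0 : 0 <= H := l2norm_ge0 mu h.
rewrite -/H in cs.
have : l2inner mu (gradf (p t) \- gradf u) h <= Lf * H ^+ 2 * t.
  apply: le_trans cs _.
  rewrite (_ : Lf * _ * t = Lf * (t * H) * H); last by ring.
  exact: ler_wpM2r.
lra.
Qed.

End descent_lemma.

(** * Almost everywhere convergence from summable squared norms *)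

Section summable_l2norm.
Context {d : measure_display} {T : measurableType d} {R : realType}.
Context (mu : {measure set T -> \bar R}).

Lemma summable_sqr_cvg0 (a : R^nat) (C : R) :
  (forall n, \sum_(0 <= k < n) a k ^+ 2 <= C) -> a @ \oo --> 0.
Proof.
move=> aC; have /cvgr0Pnorm_lt a2 : (fun k => a k ^+ 2) @ \oo --> 0.
  apply: cvg_series_cvg_0; apply: nondecreasing_is_cvgn.
    by apply: nondecreasing_series => n _ _; exact: sqr_ge0.
  by exists C => _ [n _ <-]; exact: aC.
apply/cvgr0Pnorm_lt => e e0.
have := a2 _ (exprn_gt0 2 e0); apply: filterS => k.
by rewrite normrX ltr_pXn2r// nnegrE ltW.
Qed.

(** Sum and integral can be exchanged for nonnegative terms, so the pointwise series of squares is
    integrable, hence finite almost everywhere, and its terms tend to 0. *)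
Lemma summable_l2norm_cvg0_ae (v : nat -> T -> R) (C : R) :
  (forall k, L2 mu (v k)) ->
  (forall n, \sum_(0 <= k < n) l2norm mu (v k) ^+ 2 <= C) ->
  {ae mu, forall x, v ^~ x @ \oo --> 0}.
Proof.
move=> v2 vC.
have mv k : measurable_fun [set: T] (fun x => (v k x ^+ 2)%:E).
  by apply/measurable_EFinP/measurable_funX; exact: L2_measurable (v2 k).
have v0 k x : [set: T] x -> (0 <= (v k x ^+ 2)%:E)%E by rewrite lee_fin sqr_ge0.
have s0 x : (0 <= \sum_(k <oo) (v k x ^+ 2)%:E)%E.
  by apply: nneseries_ge0 => k _ _; exact: v0.
have : mu.-integrable [set: T] (fun x => \sum_(k <oo) (v k x ^+ 2)%:E)%E.
  apply/integrableP; split.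
    by apply: ge0_emeasurable_sum => // k x Dx _; exact: v0.
  under eq_integral do rewrite gee0_abs//.
  rewrite integral_nneseries//.
  apply: (@le_lt_trans _ _ C%:E); last exact: ltry.
  apply: lime_le.
    by apply: is_cvg_nneseries => k _ _; apply: integral_ge0 => x; exact: v0.
  near=> n; apply: le_trans (_ : (\sum_(0 <= k < n) l2norm mu (v k) ^+ 2)%:E <= _)%E.
    rewrite -sumEFin le_eqVlt; apply/orP; left; apply/eqP; apply: eq_bigr => k _.
    rewrite sqr_l2norm// fineK//; apply: integrable_fin_num => //.
    exact: L2_integrable_sqr.
  by rewrite lee_fin.
move=> /(integrable_ae measurableT); apply: filterS => x /(_ Logic.I) sfin.
apply: (@summable_sqr_cvg0 _ (fine (\sum_(k <oo) (v k x ^+ 2)%:E)%E)) => n.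
rewrite -lee_fin fineK// -sumEFin.
by apply: (@nneseries_lim_ge R (fun k => (v k x ^+ 2)%:E) xpredT 0%N) => k _ _; exact: v0.
Unshelve. all: by end_near. Qed.

End summable_l2norm.

(** * Energy decrease and vanishing increments of the iterates *)

Section prox_energy.
Context {d : measure_display} {T : measurableType d} {R : realType}.
Context (mu : {finite_measure set T -> \bar R}).
Context (f : (T -> R) -> R) (gradf : (T -> R) -> (T -> R)) (Lf : R).
Context (g : R -> \bar R) (L : R).

(** The integrand of the quadratic model: [p] is the gradient value, [a] the current iterate and [b]
    the candidate. *)
Definition prox_quad (p a b : R) : R := p * (b - a) + L / 2 * (b - a) ^+ 2.

Lemma integrable_prox_quad (p a b : T -> R) : L2 mu p -> L2 mu a -> L2 mu b ->
  mu.-integrable [set: T] (fun x => (prox_quad (p x) (a x) (b x))%:E).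
Proof.
move=> p2 a2 b2; have ba2 := L2B b2 a2.
have i1 := L2_integrableM p2 ba2.
have i2 := integrableZl measurableT (L / 2) (L2_integrable_sqr ba2).
exact: (integrableD measurableT i1 i2).
Qed.

Lemma prox_modelE (a b : T -> R) : L2 mu (gradf a) -> L2 mu a -> L2 mu b ->
  prox_model mu f gradf g L a b =
  ((f a + \int[mu]_x prox_quad (gradf a x) (a x) (b x))%:E
    + \int[mu]_x g (b x))%E.
Proof.
move=> p2 a2 b2; have ba2 := L2B b2 a2; rewrite /prox_model; congr (_%:E + _)%E.
rewrite -addrA; congr (_ + _).
have i2 := integrableZl measurableT (L / 2) (L2_integrable_sqr ba2).
rewrite sqr_l2norm// -RintegralZl//; last exact: L2_integrable_sqr.
by rewrite -(@RintegralD _ _ _ mu setT (fun x => gradf a x * (b x - a x))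
  (fun x => L / 2 * (b x - a x) ^+ 2))//; exact: L2_integrableM.
Qed.

Hypothesis A : assumptionA mu f gradf Lf.
Hypothesis g_ge0 : forall x, (0 <= g x)%E.
Hypothesis g0 : g 0 = 0%E.
Context (u : nat -> T -> R).
Hypothesis itu : prox_grad_iterates mu f gradf g L u.

Lemma iterate_L2 k : L2 mu (u k).
Proof. by case: itu => u0 uk; case: k => [//|k]; case: (uk k). Qed.

Lemma gradient_L2 v : L2 mu v -> L2 mu (gradf v).
Proof. by case: A => _ [_ [_ [h _]]] /h[]. Qed.

(** The zero function is a competitor of finite model value, since [g 0 = 0]. The index starts at 1
    because [u 0] is arbitrary. *)
Lemma iterate_integral_g_fin k : (\int[mu]_x g (u k.+1 x))%E \is a fin_num.
Proof.
rewrite ge0_fin_numE; last by apply: integral_ge0.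
have c2 : L2 mu (cst 0) := Lfun_cst mu 0 2.
have u2 := iterate_L2; have [_ /(_ k)[_ /(_ _ c2)]] := itu.
have gu2 := gradient_L2 (u2 k).
rewrite !prox_modelE//; under [X in (_ <= _ + X)%E]eq_integral do rewrite g0.
rewrite integral0 adde0 => le1.
move: le1; case: (\int[mu]_x g (u k.+1 x))%E => [r _||//]; first exact: ltry.
by rewrite addey.
Qed.

(** Since [fine] sends an infinite value to 0, this is sure to be the true energy only from index 1
    on. *)
Definition energy k : R := f (u k) + fine (\int[mu]_x g (u k x))%E.

(** The base point [u k.+1] competes in its own step, where its quadratic part vanishes; the descent
    lemma then replaces the linear model by [f (u k.+2)], leaving the gap [L - Lf]. *)
Lemma energy_decrease k : energy k.+2 +
  (L - Lf) / 2 * l2norm mu (u k.+2 \- u k.+1) ^+ 2 <= energy k.+1.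
Proof.
have u2 := iterate_L2; have [_ /(_ k.+1)[_ /(_ _ (u2 k.+1))]] := itu.
have uu2 := L2B (u2 k.+2) (u2 k.+1).
have gu2 := gradient_L2 (u2 k.+1).
rewrite [X in (_ <= X)%E]prox_modelE// /prox_model.
have -> : \int[mu]_x prox_quad (gradf (u k.+1) x) (u k.+1 x) (u k.+1 x) = 0.
  under eq_Rintegral do rewrite /prox_quad subrr expr0n/= !mulr0 addr0.
  by rewrite Rintegral_cst// mul0r.
rewrite addr0 -(fineK (iterate_integral_g_fin k)).
rewrite -(fineK (iterate_integral_g_fin k.+1)) -!EFinD lee_fin.
have := descent_lemma A (u2 k.+1) (u2 k.+2).
rewrite /energy; lra.
Qed.

Hypothesis LfL : Lf < L.

(** The energy decrease telescopes, and the energy is bounded below by the bound [c] of [f] because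
    [g] is nonnegative; the squared increments are therefore summable. *)
Lemma iterate_increment_cvg0 :
  {ae mu, forall x, (fun k => u k.+1 x - u k x) @ \oo --> 0}.
Proof.
have [_ [[c cf] _]] := A.
suff : {ae mu, forall x, (fun k => u k.+2 x - u k.+1 x) @ \oo --> 0}.
  by apply: filterS => x; rewrite -(@cvg_shiftS _ (fun k => u k.+1 x - u k x)).
apply: (@summable_l2norm_cvg0_ae _ _ _ mu (fun k x => u k.+2 x - u k.+1 x)
  ((energy 1 - c) / ((L - Lf) / 2))).
  by move=> k; apply: L2B; exact: iterate_L2.
move=> n; rewrite ler_pdivlMr ?divr_gt0 ?subr_gt0//.
suff : (\sum_(0 <= k < n) l2norm mu (u k.+2 \- u k.+1) ^+ 2) * ((L - Lf) / 2)
    + energy n.+1 <= energy 1.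
  have : c <= energy n.+1.
    rewrite /energy -[c]addr0 lerD ?cf//; first exact: iterate_L2.
    by rewrite fine_ge0// integral_ge0.
  move=> h1 h2; rewrite lerBrDr; apply: le_trans h2.
  by rewrite lerD2l.
elim: n => [|n IH]; first by rewrite big_geq// mul0r add0r.
rewrite big_nat_recr//= mulrDl -addrA; apply: le_trans IH.
rewrite lerD2l mulrC addrC; exact: energy_decrease.
Qed.

End prox_energy.

(** * From minimality of the integral to minimality of the integrand *)

Section pointwise_minimality.
Context {d : measure_display} {T : measurableType d} {R : realType}.

(* The graph of [g] is separable, so a countable set of competitors suffices. *)
Lemma countable_competitors (g : R -> \bar R) : (forall x, (0 <= g x)%E) ->
  exists D : nat -> R, forall (phi : R -> R) (M : \bar R), continuous phi ->
    (forall n, (M <= (phi (D n))%:E + g (D n))%E) ->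
    forall v, (M <= (phi v)%:E + g v)%E.
Proof.
move=> g_ge0.
pose A (t : rat * rat * rat) := [set w : R | ratr t.1.1 < w < ratr t.1.2 /\
  (g w < (ratr t.2)%:E)%E].
(* One point is chosen per rational box meeting the region above the graph. Invalid codes and empty
   boxes yield 0, which is merely one more competitor. *)
exists (fun n => if unpickle n is Some t then xget 0 (A t) else 0).
move=> phi M cphi HM v.
case gv : (g v) (g_ge0 v) => [r| |]// _; last by rewrite addey// leey.
rewrite -EFinD; apply/lee_addgt0Pr => e e0.
have e20 : 0 < e / 2 by lra.
have /cvgrPdist_lt/(_ _ e20) := cphi v.
move=> /nbhs_ballP[dl /= dl0 near_phi].
(* A rational box around [(v, r)] is chosen so that its point [w] loses at most [e / 2] in [phi] and
   at most [e / 2] in [g]. *)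
have [p] := @rat_in_itvoo R (v - dl) v ltac:(lra).
rewrite in_itv/= => /andP[p1 p2].
have [q] := @rat_in_itvoo R v (v + dl) ltac:(lra).
rewrite in_itv/= => /andP[q1 q2].
have [s] := @rat_in_itvoo R r (r + e / 2) ltac:(lra).
rewrite in_itv/= => /andP[s1 s2].
have := HM (pickle (p, q, s)); rewrite pickleK.
have Av : A (p, q, s) v by split; rewrite /= ?p2 ?q1// gv lte_fin.
have [/= /andP[pw wq] gw] : A (p, q, s) (xget 0 (A (p, q, s))).
  by apply: (xgetPex 0); exists v.
move: pw wq gw; set w := xget _ _ => pw wq gw.
move=> /le_trans; apply.
have : `|phi v - phi w| < e / 2.
  apply: near_phi; rewrite /ball/= ltr_norml; apply/andP; split; lra.
rewrite ltr_norml => /andP[h1 h2].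
apply: (@le_trans _ _ ((phi w)%:E + (ratr s)%:E)%E).
  by rewrite leeD2l// ltW.
by rewrite -!EFinD lee_fin; lra.
Qed.

Context (mu : {finite_measure set T -> \bar R}).
Context (f : (T -> R) -> R) (gradf : (T -> R) -> (T -> R)).
Context (g : R -> \bar R) (L : R).
Hypothesis mg : measurable_fun [set: R] g.
Hypothesis g_ge0 : forall x, (0 <= g x)%E.

(** The competitor [w] switches from [b] to [v] exactly where [v] is strictly better. Minimality of
    [b] makes the integrals agree, so the switching set is null. *)
Lemma prox_step_const (a b : T -> R) (v : R) :
  L2 mu (gradf a) -> L2 mu a -> L2 mu b ->
  (\int[mu]_x g (b x) \is a fin_num)%E ->
  (forall w, L2 mu w -> prox_model mu f gradf g L a b <=
    prox_model mu f gradf g L a w)%E ->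
  {ae mu, forall x, ((prox_quad L (gradf a x) (a x) (b x))%:E + g (b x) <=
    (prox_quad L (gradf a x) (a x) v)%:E + g v)%E}.
Proof.
move=> p2 a2 b2 gbfin bmin.
case gv : (g v) (g_ge0 v) => [r| |]// r0; last first.
  by apply: aeW => x; rewrite addey// leey.
have mb := L2_measurable b2.
have mgb : measurable_fun [set: T] (fun x => g (b x)) by exact: measurableT_comp.
have igb : mu.-integrable [set: T] (fun x => g (b x)).
  apply/integrableP; split => //.
  under eq_integral do rewrite gee0_abs//.
  by rewrite -ge0_fin_numE// integral_ge0.
have gb_fin := integrable_ae measurableT igb.
(* A real-valued version of [g (b x)], equal to it almost everywhere because an integrable function
   is almost everywhere finite. *)
pose gb x := fine (g (b x)).
have gb0 x : 0 <= gb x by exact: fine_ge0.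
have mgb' : measurable_fun [set: T] gb by exact: measurableT_comp.
have gbE : ae_eq mu [set: T] (fun x => g (b x)) (EFin \o gb).
  by apply: filterS gb_fin => x h /h gf; rewrite /gb /= fineK.
have igb' : mu.-integrable [set: T] (EFin \o gb).
  apply/integrableP; split; first exact/measurable_EFinP.
  rewrite (_ : (\int[mu]_x _)%E = \int[mu]_x g (b x))%E; last first.
    apply: ae_eq_integral => //.
      by apply: measurableT_comp => //; exact/measurable_EFinP.
    by apply: filterS gbE => x h /h /= ->; rewrite ger0_norm.
  by rewrite -ge0_fin_numE// integral_ge0.
have c2 : L2 mu (cst v) := Lfun_cst mu v 2.
have iqb := integrable_prox_quad L p2 a2 b2.
have iqv := integrable_prox_quad L p2 a2 c2.
pose qb x := prox_quad L (gradf a x) (a x) (b x).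
pose qv x := prox_quad L (gradf a x) (a x) v.
pose c x := qv x + r < qb x + gb x.
have mqb : measurable_fun [set: T] qb.
  by apply/measurable_EFinP/(measurable_int mu iqb).
have mqv : measurable_fun [set: T] qv.
  by apply/measurable_EFinP/(measurable_int mu iqv).
have mc : measurable_fun [set: T] c.
  by apply: measurable_fun_ltr; apply: measurable_funD.
pose w x := if c x then v else b x.
have w2 : L2 mu w by exact: (L2_if mc c2 b2).
have iqw := integrable_prox_quad L p2 a2 w2.
pose gw x := if c x then r else gb x.
have mgw : measurable_fun [set: T] gw by exact: measurable_fun_ifT.
have igw : mu.-integrable [set: T] (EFin \o gw).
  apply: (@le_integrable _ _ _ mu _ measurableT _ (fun x => (r%:E + (gb x)%:E)%E)).
  - exact/measurable_EFinP.
  - move=> x _; rewrite -EFinD !abse_EFin lee_fin ger0_norm /gw; last by case: ifP.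
    by rewrite ger0_norm ?addr_ge0//; case: ifP; rewrite ?lerDl ?lerDr.
  - by apply: integrableD => //; exact: finite_measure_integrable_cst.
have igbE : (\int[mu]_x g (b x) = (\int[mu]_x gb x)%:E)%E.
  rewrite fineK; last exact: integrable_fin_num.
  by apply: ae_eq_integral => //; exact/measurable_EFinP.
have igwE : (\int[mu]_x g (w x) = (\int[mu]_x gw x)%:E)%E.
  rewrite fineK; last exact: integrable_fin_num.
  apply: ae_eq_integral => //; last 2 first.
  - exact/measurable_EFinP.
  - apply: filterS gbE => x h /h /=; rewrite /w /gw.
    by case: ifP.
  - by apply: measurableT_comp => //; exact: L2_measurable w2.
have := bmin _ w2; rewrite !prox_modelE// igbE igwE -!EFinD lee_fin -!addrA lerD2l.
rewrite -!RintegralD// => le1.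
have : {ae mu, forall x, qb x + gb x = prox_quad L (gradf a x) (a x) (w x) + gw x}.
  apply: le_Rintegral_eq_ae le1.
  - exact: (integrableD measurableT iqw igw).
  - exact: (integrableD measurableT iqb igb').
  - by move=> x; rewrite /w /gw; case: ifP => // /ltW.
apply: filterS2 gb_fin => x /(_ Logic.I) gfin eqx.
rewrite -(fineK gfin) -!EFinD lee_fin -/(gb x) -/(qb x) -/(qv x).
move: eqx; rewrite /w /gw; case: ifP => [cx eqx|/negbT]; last by rewrite -leNgt.
by move: cx; rewrite /c eqx ltxx.
Qed.

(** Each competitor has its own null set; a countable family of competitors gives a common one, and
    continuity of [prox_quad] extends the inequality to every [v]. *)
Lemma prox_step_pointwise (a b : T -> R) :
  L2 mu (gradf a) -> L2 mu a -> L2 mu b ->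
  (\int[mu]_x g (b x) \is a fin_num)%E ->
  (forall w, L2 mu w -> prox_model mu f gradf g L a b <=
    prox_model mu f gradf g L a w)%E ->
  {ae mu, forall x, forall v, ((prox_quad L (gradf a x) (a x) (b x))%:E + g (b x) <=
    (prox_quad L (gradf a x) (a x) v)%:E + g v)%E}.
Proof.
move=> p2 a2 b2 gbfin bmin; have [D HD] := countable_competitors g_ge0.
have := ae_foralln (fun n => prox_step_const (D n) p2 a2 b2 gbfin bmin).
apply: filterS => x Hx; apply: HD Hx => v.
rewrite /prox_quad; apply: cvgD.
  by apply: cvgMr; apply: cvgB; [exact: cvg_id|exact: cvg_cst].
by apply: cvgMr; apply: cvgM; apply: cvgB; (exact: cvg_id || exact: cvg_cst).
Qed.

End pointwise_minimality.

(** * Pointwise bounds inherited by weak limits *)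

Section weak_limit_bounds.
Context {d : measure_display} {T : measurableType d} {R : realType}.
Context (mu : {finite_measure set T -> \bar R}).

(** Testing weak convergence against the indicator of the exceptional set [E] bounds the integral of
    [w] over [E] by that of [q], although [w] exceeds [q] on [E]; so [E] is null. Rational bounds
    leave only countably many such sets. *)
Lemma weak_limit_le (v : nat -> T -> R) (w : T -> R) :
  (forall k, L2 mu (v k)) -> L2 mu w -> weak_cvg mu v w ->
  {ae mu, forall x, forall (q : rat) N,
    (forall k, (N <= k)%N -> v k x <= ratr q) -> w x <= ratr q}.
Proof.
move=> v2 w2 vw.
suff H (q : rat) N :
    {ae mu, forall x, (forall k, (N <= k)%N -> v k x <= ratr q) -> w x <= ratr q}.
  pose P n x := if unpickle n is Some (q, N) then
    (forall k, (N <= k)%N -> v k x <= ratr q) -> w x <= ratr q else True.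
  have : {ae mu, forall x, forall n, P n x}.
    apply: ae_foralln => n; rewrite /P; case: (unpickle n) => [[q N]|]; first exact: H.
    exact: aeW.
  by apply: filterS => x Px q N; have := Px (pickle (q, N)); rewrite /P pickleK.
pose E := [set x | ratr q < w x] `&` \bigcap_(k in [set k | (N <= k)%N])
  [set x | v k x <= ratr q].
have mE : measurable E.
  apply: measurableI.
    have := measurable_fun_ltr (measurable_cst (ratr q : R)) (L2_measurable w2).
    by move=> /(_ measurableT [set true]); rewrite setTI; exact.
  apply: bigcap_measurable => [|k _]; first by exists N => /=.
  have := measurable_fun_ler (L2_measurable (v2 k)) (measurable_cst (ratr q : R)).
  by move=> /(_ measurableT [set true]); rewrite setTI; exact.
have mbE : measurable_fun [set: T] (fun x => x \in E).
  apply: (measurable_fun_bool true); rewrite setTI.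
  rewrite (_ : _ @^-1` _ = E)//; apply/seteqP; split => x /=; first by move/set_mem.
  exact: mem_set.
(* This indicator is an admissible test function because constants are square-integrable for a
   finite measure. *)
pose e x : R := if x \in E then 1 else 0.
have cst2 c : L2 mu (cst c) := Lfun_cst mu c 2.
have e2 : L2 mu e by exact: (L2_if mbE (cst2 1) (cst2 0)).
have : {ae mu, forall x, w x * e x = ratr q * e x}.
  apply: le_Rintegral_eq_ae.
  - exact: (L2_integrableM (cst2 (ratr q)) e2).
  - exact: (L2_integrableM w2 e2).
  - move=> x; rewrite /e; case: ifP => [/set_mem[/= qw _]|]; last by rewrite !mulr0.
    by rewrite !mulr1 ltW.
  - have cw := vw _ e2.
    rewrite -[leLHS](cvg_lim _ cw)//; apply: limr_le; first by apply/cvg_ex; eexists; exact: cw.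
    near=> k; apply: le_Rintegral => //.
    + exact: (L2_integrableM (v2 k) e2).
    + exact: (L2_integrableM (cst2 (ratr q)) e2).
    + move=> x _; rewrite /e; case: ifP => [/set_mem[_ /= vq]|]; last by rewrite !mulr0.
      by rewrite !mulr1; apply: vq => /=; near: k; exact: nbhs_infty_ge.
apply: filterS => x; rewrite /e; case: ifPn => [/set_mem[/= qw _]|/negP xE _ vq].
  by rewrite !mulr1 => wq; move: qw; rewrite wq ltxx.
rewrite leNgt; apply/negP => qw; apply: xE; exact/mem_set.
Unshelve. all: by end_near. Qed.

Lemma weak_limit_ge (v : nat -> T -> R) (w : T -> R) :
  (forall k, L2 mu (v k)) -> L2 mu w -> weak_cvg mu v w ->
  {ae mu, forall x, forall (q : rat) N,
    (forall k, (N <= k)%N -> ratr q <= v k x) -> ratr q <= w x}.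
Proof.
move=> v2 w2 vw.
have N2 (y : T -> R) : L2 mu y -> L2 mu (fun x => - y x).
  by move=> /(L2Z (-1)); under eq_fun do rewrite mulN1r.
have NE (y z : T -> R) : L2 mu y -> L2 mu z ->
    l2inner mu (fun x => - y x) z = - l2inner mu y z.
  move=> y2 z2; rewrite -[RHS]mulN1r -[RHS]RintegralZl//.
    by apply: eq_Rintegral => x _; rewrite mulN1r mulNr.
  exact: L2_integrableM.
have : weak_cvg mu (fun k x => - v k x) (fun x => - w x).
  move=> z z2; rewrite NE//; under eq_fun do rewrite NE//.
  by apply: cvgN; exact: vw.
move/weak_limit_le => /(_ (fun k => N2 _ (v2 k)) (N2 _ w2)).
apply: filterS => x Hx q N vq; have := Hx (- q) N.
rewrite rmorphN lerN2; apply => k Nk; rewrite lerN2; exact: vq.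
Qed.

End weak_limit_bounds.

(** * Cluster points of real sequences and passage to the limit in the minimality *)

Section pointwise_limit.
Context {R : realType}.

(* With increments tending to 0, the sequence cannot jump across a
   neighbourhood of [c], so avoiding it would keep it on one side of [c]. *)
Lemma cluster_of_small_increments (a : R^nat) (c : R) :
  (fun k => a k.+1 - a k) @ \oo --> 0 ->
  (forall (q : rat) N, (forall k, (N <= k)%N -> a k <= ratr q) -> c <= ratr q) ->
  (forall (q : rat) N, (forall k, (N <= k)%N -> ratr q <= a k) -> ratr q <= c) ->
  forall e N, 0 < e -> exists2 k, (N <= k)%N & `|a k - c| < e.
Proof.
move=> /cvgr0Pnorm_lt da cle cge e N e0; apply: contrapT => H.
have far k : (N <= k)%N -> e <= `|a k - c|.
  by move=> Nk; rewrite leNgt; apply/negP => ?; apply: H; exists k.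
have [M _ MH] := da _ e0.
pose K := maxn N M.
have step k : (K <= k)%N -> `|a k.+1 - a k| < e /\ e <= `|a k - c|.
  rewrite geq_max => /andP[Nk Mk]; split; [exact: MH|exact: far].
have : e <= `|a K - c| by case: (step K (leqnn _)).
rewrite ler_normr => /orP[aK|aK].
(* Crossing from one side of [c] to the other would require a jump of at least [2 e]. *)
- have up k : (K <= k)%N -> e <= a k - c.
    elim: k => [|k IH]; first by rewrite leqn0 => /eqP K0; rewrite K0 in aK.
    rewrite leq_eqVlt => /predU1P[<-//|]; rewrite ltnS => Kk.
    have [+ _] := step k Kk; have [_] := step k.+1 (leqW Kk).
    have := IH Kk; rewrite ler_normr ltr_norml => ? /orP[//|?] /andP[? ?]; lra.
  (* A rational strictly above [c] that bounds the tail from below contradicts [cge]. *)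
  have [q] := @rat_in_itvoo R c (c + e) ltac:(lra).
  rewrite in_itv/= => /andP[q1 q2].
  have : ratr q <= c by apply: (cge q K) => k /up; lra.
  lra.
- have dn k : (K <= k)%N -> e <= - (a k - c).
    elim: k => [|k IH]; first by rewrite leqn0 => /eqP K0; rewrite K0 in aK.
    rewrite leq_eqVlt => /predU1P[<-//|]; rewrite ltnS => Kk.
    have [+ _] := step k Kk; have [_] := step k.+1 (leqW Kk).
    have := IH Kk; rewrite ler_normr ltr_norml => ? /orP[?|//] /andP[? ?]; lra.
  have [q] := @rat_in_itvoo R (c - e) c ltac:(lra).
  rewrite in_itv/= => /andP[q1 q2].
  have : c <= ratr q by apply: (cle q K) => k /dn; lra.
  lra.
Qed.

(** Along indices with [a k.+1] close to [c], vanishing increments bring the base point [a k] to [c]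
    as well, which is why the limiting quadratic is centred at [c] itself. Lower semicontinuity
    handles [g (a k.+1)]. *)
Lemma GL_cluster (L : R) (g : R -> \bar R) (a p : R^nat) (c pl : R) :
  lower_semicontinuous g -> (forall x, (0 <= g x)%E) ->
  p @ \oo --> pl -> (fun k => a k.+1 - a k) @ \oo --> 0 ->
  (forall e N, 0 < e -> exists2 k, (N <= k)%N & `|a k - c| < e) ->
  (forall k v, ((prox_quad L (p k) (a k) (a k.+1))%:E + g (a k.+1) <=
    (prox_quad L (p k) (a k) v)%:E + g v)%E) ->
  GL L g (- pl) c.
Proof.
move=> lsc g_ge0 pcvg dcvg clus amin v.
have /choice[s sP] (j : nat) : exists k, (j <= k)%N /\ `|a k.+1 - c| < j.+1%:R^-1.
  (* Asking for an index at least [j.+1] ensures that it is a successor [k.+1] with [j <= k]. *)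
  have [[//|k]] := @clus j.+1%:R^-1 j.+1 ltac:(by []).
  by rewrite ltnS => jk ak; exists k.
have soo : s @ \oo --> \oo.
  apply/cvgnyPge => N; exists N => // j /= Nj; have [js _] := sP j.
  exact: leq_trans Nj js.
have a1 : (fun j => a (s j).+1) @ \oo --> c.
  apply/cvgrPdist_lt => e e0; near=> j; rewrite distrC.
  have [_ /lt_trans] := sP j; apply.
  by near: j; exact: near_infty_natSinv_lt (PosNum e0).
have ds : (fun j => a (s j).+1 - a (s j)) @ \oo --> 0.
  exact: (cvg_comp _ _ soo dcvg).
have ps : (fun j => p (s j)) @ \oo --> pl by exact: (cvg_comp _ _ soo pcvg).
have a0 : (fun j => a (s j)) @ \oo --> c.
  have -> : (fun j => a (s j)) = (fun j => a (s j).+1 - (a (s j).+1 - a (s j))).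
    by apply/funext => j; rewrite subKr.
  by rewrite -[c]subr0; exact: cvgB.
case gv : (g v) (g_ge0 v) => [r| |]// _; last by rewrite addey// leey.
rewrite leNgt; apply/negP => Hlt.
(* The negated claim says exactly that [rho] lies below [g c]; [m] is then placed strictly between
   them. *)
pose rho := pl * (v - c) + L / 2 * (v - c) ^+ 2 + r.
have [m rm mg] : exists2 m, rho < m & (m%:E < g c)%E.
  move: Hlt; case gc : (g c) (g_ge0 c) => [t| |]// _.
    rewrite -!EFinD lte_fin subrr => Hlt.
    exists ((rho + t) / 2); rewrite ?lte_fin /rho; move: Hlt; rewrite expr0n/=; lra.
  by move=> _; exists (rho + 1); rewrite ?ltry//; lra.
have [V cV VP] := lsc _ _ mg.
(* Minimality of step [s j] bounds [g (a (s j).+1)] by [X j]. As [X] tends to [rho], it falls below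
   [m], while lower semicontinuity keeps [g] above [m]. *)
pose X j := prox_quad L (p (s j)) (a (s j)) v + r
  - prox_quad L (p (s j)) (a (s j)) (a (s j).+1).
have Xcvg : X @ \oo --> rho.
  (* The limit is written factor by factor like [X]; the zeros are limits of increments. *)
  have -> : rho = pl * (v - c) + L / 2 * ((v - c) * (v - c)) + r -
    (pl * 0 + L / 2 * (0 * 0)) by rewrite /rho; ring.
  rewrite /X /prox_quad.
  have vc : (fun j => v - a (s j)) @ \oo --> v - c by apply: cvgB => //; exact: cvg_cst.
  apply: cvgB; [apply: cvgD; [apply: cvgD|exact: cvg_cst]|apply: cvgD].
  - exact: cvgM.
  - by apply: cvgMr; exact: cvgM.
  - exact: cvgM.
  - by apply: cvgMr; exact: cvgM.
have [j] : exists j, X j < m /\ V (a (s j).+1).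
  near \oo => j; exists j; split; near: j.
    exact: (cvgr_lt _ Xcvg).
  exact: a1.
move=> [Xm /VP mga].
have := amin (s j) v; rewrite gv -EFinD.
case: (g (a (s j).+1)) mga => [t| |]//; rewrite -?EFinD ?lee_fin ?lte_fin//.
move: Xm; rewrite /X; lra.
Unshelve. all: by end_near. Qed.

End pointwise_limit.

(** * The weak limit point as a pointwise cluster point satisfying the inclusion *)

Theorem theorem4p12 (d : measure_display) (T : measurableType d) (R : realType)
  (mu : {finite_measure set T -> \bar R})
  (f : (T -> R) -> R) (gradf : (T -> R) -> (T -> R)) (Lf : R)
  (g : R -> \bar R) (L : R) (u : nat -> T -> R) (ustar : T -> R) :
  assumptionA mu f gradf Lf ->
  assumptionB g ->
  Lf < L ->
  prox_grad_iterates mu f gradf g L u ->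
  L2 mu ustar ->
  weak_seq_limit_point mu u ustar ->
  {ae mu, forall x, (fun k => gradf (u k) x) @ \oo --> gradf ustar x} ->
  {ae mu, forall x, GL L g (- gradf ustar x) (ustar x)}.
Proof.
move=> A [lsc [_ [g0 [_ [_ g_ge0]]]]] LfL itu us2 [phi [phi_inc uphi]] gcvg.
have u2 := iterate_L2 itu.
have mg := lower_semicontinuous_measurable lsc.
have phi_ge j : (j <= phi j)%N.
  by elim: j => // j /leq_ltn_trans; apply; exact: phi_inc.
have umin : {ae mu, forall x, forall k v,
    ((prox_quad L (gradf (u k) x) (u k x) (u k.+1 x))%:E + g (u k.+1 x) <=
     (prox_quad L (gradf (u k) x) (u k x) v)%:E + g v)%E}.
  apply: ae_foralln => k; apply: (@prox_step_pointwise _ _ _ mu f) => //.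
  - exact: (gradient_L2 A (u2 k)).
  - exact: (iterate_integral_g_fin A g_ge0 g0 itu).
  - by case: itu => _ /(_ k)[].
have du := iterate_increment_cvg0 A g_ge0 g0 itu LfL.
have ule := weak_limit_le (fun j => u2 (phi j)) us2 uphi.
have uge := weak_limit_ge (fun j => u2 (phi j)) us2 uphi.
near=> x.
have dux : (fun k => u k.+1 x - u k x) @ \oo --> 0 by near: x.
(* The clustering indices need not lie in the range of [phi], so the gradients are taken along the
   whole sequence. *)
apply: (@GL_cluster _ L g (fun k => u k x) (fun k => gradf (u k) x)) => //.
- by near: x.
- have ulex : forall (q : rat) N, (forall j, (N <= j)%N -> u (phi j) x <= ratr q) ->
    ustar x <= ratr q by near: x.
  have ugex : forall (q : rat) N, (forall j, (N <= j)%N -> ratr q <= u (phi j) x) ->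
    ratr q <= ustar x by near: x.
  (* A tail bound for the whole sequence restricts to the subsequence because [j <= phi j]. *)
  apply: cluster_of_small_increments => // q N uq; [apply: (ulex q N)|apply: (ugex q N)];
    by move=> j Nj; apply: uq; exact: leq_trans (phi_ge j).
- by near: x.
Unshelve. all: by end_near. Qed.
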